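(* Let $N\ge2$ be an integer and let $g\in L^1([0,1])$ satisfy $\lim_{t\to\infty}e^{(N-3)t}\int_0^{e^{-t}}g(s)\,ds=0$. Fix one of the two boundary conditions at $t=0$: either (D) $z(0)=0$, or (Nav) $z'(0)-(N-2)z(0)=0$. Let $X$ be the Banach space of $z\in C^2([0,\infty))$ satisfying the chosen condition at $0$ and $e^tz^{(j)}(t)\to0$ as $t\to\infty$ for $j=0,1,2$, with norm $\|z\|_X=\sum_{j=0}^2\sup_{t\ge0}e^t|z^{(j)}(t)|$, and let $Y$ be the Banach space of $h\in C([0,\infty))$ with $e^th(t)\to0$ as $t\to\infty$, with norm $\sup_{t\ge0}e^t|h(t)|$. Define $\mathcal{F}:X\times\mathbb{R}\to Y$ by $$\mathcal{F}(z,\lambda)(t)=-z''(t)+(N-4)z'(t)+(2N-4)z(t)-\frac{N-1}{2}z(t)^2-\lambda e^{(N-4)t}\int_0^{e^{-t}}g(s)\,ds.$$ Then there exist a neighborhood $U\subset X$ of $0$ and an open neighborhood $I\subset\mathbb{R}$ of $0$ such that for every $\lambda\in I$ there is a unique $z(\lambda)\in U$ with $\mathcal{F}(z(\lambda),\lambda)=0$. Moreover, the map $I\ni\lambda\mapsto z(\lambda)\in X$ is of class $C^1$, $z(0)=0$, and the linear map $\mathcal{F}_z(z(\lambda),\lambda):X\to Y$ is bijective for every $\lambda\in I$. *)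

(* Defs.v *)
From HB Require Import structures.
From mathcomp Require Import all_boot all_order all_algebra.
From mathcomp Require Import all_classical all_reals all_analysis.
Set Implicit Arguments. Unset Strict Implicit. Unset Printing Implicit Defensive.
Import Order.TTheory GRing.Theory Num.Theory.
Import numFieldNormedType.Exports.
Local Open Scope classical_set_scope.
Local Open Scope ring_scope.

Section Defs.
Variable R : realType.
Implicit Types (f z h : R -> R) (t : R).

(* Functions on [0,oo) are represented as R -> R; values at t < 0 are
   irrelevant.  The derivative on [0,oo): the usual (two-sided) derivative
   at t > 0 and the right derivative at t = 0. *)
Definition dR f : R -> R := fun t =>
  if t == 0 then lim ((fun s => (f s - f 0) / s) @ 0^'+) else derive1 f t.

Definition C1_0inf f : Prop :=
  [/\ forall t, 0 < t -> derivable f t 1,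
      cvg ((fun s => (f s - f 0) / s) @ 0^'+),
      {within `[0, +oo[, continuous f} &
      {within `[0, +oo[, continuous (dR f)}].

Definition C2_0inf f : Prop := C1_0inf f /\ C1_0inf (dR f).

Inductive bcond := Dirichlet | Navier.

Definition bc_holds (N : nat) (b : bcond) z : Prop :=
  match b with
  | Dirichlet => z 0 = 0
  | Navier => dR z 0 - (N%:R - 2) * z 0 = 0
  end.

Definition wsup f : R := sup [set expR t * `|f t| | t in [set t | 0 <= t]].

Definition decays f : Prop := (fun t => expR t * f t) @ +oo --> 0.

Definition inX (N : nat) (b : bcond) z : Prop :=
  [/\ C2_0inf z, bc_holds N b z, decays z, decays (dR z) & decays (dR (dR z))].

Definition Xnorm z : R := wsup z + wsup (dR z) + wsup (dR (dR z)).

Definition inY h : Prop := {within `[0, +oo[, continuous h} /\ decays h.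

Definition Ynorm h : R := wsup h.

(* equality of elements of X / Y: agreement on [0,oo) *)
Definition eq0inf f1 f2 : Prop := forall t, 0 <= t -> f1 t = f2 t.

Definition Gint (g : R -> R) (a : R) : R :=
  Rintegral lebesgue_measure `[0, a] g.

Definition Fmap (N : nat) (g : R -> R) (z : R -> R) (lam : R) : R -> R :=
  fun t => - dR (dR z) t + (N%:R - 4) * dR z t + (2 * N%:R - 4) * z t
           - (N%:R - 1) / 2 * (z t) ^+ 2
           - lam * expR ((N%:R - 4) * t) * Gint g (expR (- t)).

End Defs.

(* Main.v *)
(* Put a = N - 2 >= 0.  The linearization at 0 factors as
   -z'' + (N-4) z' + (2N-4) z = -(D - a)(D + 2) z.  Solving the unstable factor
   from infinity and the stable factor from 0 shows that it is an isomorphism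
   X -> Y whose inverse K has norm at most 9 N: the homogeneous solutions are
   e^(a t), excluded by the decay, and e^(-2 t), excluded by either boundary
   condition.  In the unknown u = -z'' + (N-4) z' + (2N-4) z the problem is the
   quadratic equation u = B(u, u) + lambda k in Y, with
   B(u, w) = (N-1)/2 K u K w and k(t) = e^((N-4) t) \int_0^(e^(-t)) g.
   On a small ball 2 B(u, .) is a contraction of ratio 1/2, which gives existence,
   uniqueness, the invertibility of F_z, and the derivative v(lambda), the solution
   of v = 2 B(u(lambda), v) + k. *)
Require Import Defs.
From HB Require Import structures.
From mathcomp Require Import all_boot all_order all_algebra.
From mathcomp Require Import ring lra.
From mathcomp Require Import all_classical all_reals all_analysis.
Import Order.TTheory GRing.Theory Num.Theory.
Import numFieldNormedType.Exports.
Local Open Scope classical_set_scope.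
Local Open Scope ring_scope.
Set Implicit Arguments. Unset Strict Implicit. Unset Printing Implicit Defensive.

(** * The weighted supremum and the algebra of [Y] *)

Section WeightedSup.
Variable R : realType.
Implicit Types (f g : R -> R) (a m t : R).

(** [X] and [Y] never become types: their elements are functions on the whole line, compared by
    [eq0inf], so completeness of [Y] and the contraction principle are proved for such
    representatives. Passing to [u] moves the nonlinear problem into [Y], whose norm involves no
    derivative; the regularity of [z] is carried by [K] alone. [wsup] is a true supremum only for
    functions known to be bounded, since [sup] defaults to 0; hence the membership hypotheses in
    nearly every estimate. Bounds on solutions of the two first-order equations do not estimate
    integrals: they compare a derivative with that of an explicit exponential ([increment_le]). The
    comparison may start at any [T >= 0], so the same lemma gives a norm bound ([T = 0]) and decay
    ([T] large). *)

Definition cont0 f := {within `[0, +oo[, continuous f}.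

Lemma wsup_le f m : (forall t, 0 <= t -> expR t * `|f t| <= m) -> wsup f <= m.
Proof.
move=> fm; apply: ge_sup; first by exists (expR 0 * `|f 0|), 0 => //=.
by move=> _ [t /= t0 <-]; exact: fm.
Qed.

(** No membership in [inY] is asked: a set without supremum gets [sup] equal to 0. *)
Lemma wsup_ge0 f : 0 <= wsup f.
Proof.
have [h|/sup_out] := pselect (has_sup [set expR t * `|f t| | t in [set t : R | 0 <= t]]);
  last by rewrite /wsup => ->.
apply: (@le_trans _ _ (expR 0 * `|f 0|)).
  by rewrite mulr_ge0 ?expR_ge0.
by apply: ub_le_sup; [case: h | exists 0 => /=].
Qed.

Lemma eq_wsup f g : eq0inf f g -> wsup f = wsup g.
Proof.
move=> fg; rewrite /wsup; congr sup; apply/seteqP; split=> _ [t /= t0 <-];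
  by exists t => //; rewrite fg.
Qed.

Lemma decaysP f : decays f <->
  forall e : R, 0 < e -> exists2 T : R, 0 <= T & forall t, T <= t -> expR t * `|f t| <= e.
Proof.
rewrite /decays; split=> [/cvgrPdist_le fd e e0|fd].
  have [M [_ Mf]] := fd e e0.
  exists (Num.max 0 (M + 1)); first by rewrite le_max lexx.
  move=> t; rewrite ge_max => /andP[_ Mt].
  have := Mf t; rewrite /= sub0r normrN normrM gtr0_norm ?expR_gt0//; apply.
  by rewrite (lt_le_trans _ Mt)// ltrDl.
apply/cvgrPdist_le => e e0; have [T T0 Tf] := fd e e0.
exists T; split=> [|t /ltW Tt] /=; first exact: ger0_real.
by rewrite sub0r normrN normrM gtr0_norm ?expR_gt0//; exact: Tf.
Qed.

(** Decay bounds the weighted function by 1 past some [T], and on the compact interval up to [T] it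
    attains a maximum. This makes the supremum in [wsup] genuine. *)
Lemma inY_bounded f : inY f -> exists M, forall t, 0 <= t -> expR t * `|f t| <= M.
Proof.
move=> [cf /decaysP df]; have [T T0 Tf] := df 1 ltr01.
pose g t := expR t * `|f t|.
have cg0 : {within `[0, +oo[, continuous g}.
  move=> x; apply: cvgM; last by apply: cvg_norm; exact: cf.
  by apply: continuous_subspaceT; exact: continuous_expR.
have sT : [set` `[0, T]] `<=` [set` `[0, +oo[].
  by move=> x /=; rewrite !in_itv /= andbT => /andP[].
have cg : {within `[0, T], continuous g} by exact: continuous_subspaceW cg0.
have [c _ cmax] := EVT_max T0 cg.
exists (Num.max 1 (expR c * `|f c|)) => t t0; rewrite le_max.
have [/Tf -> //|/ltW tT] := leP T t.
by rewrite cmax ?orbT// in_itv/= t0.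
Qed.

Lemma le_wsup f : inY f -> forall t, 0 <= t -> expR t * `|f t| <= wsup f.
Proof.
move=> /inY_bounded [M fM] t t0; apply: ub_le_sup; last by exists t.
by exists M => _ [s /= s0 <-]; exact: fM.
Qed.

Lemma norm_le_wsup f : inY f -> forall t, 0 <= t -> `|f t| <= wsup f.
Proof.
move=> fY t t0; apply: (le_trans _ (le_wsup fY t0)).
by rewrite ler_peMl// -expR0 ler_expR.
Qed.

Lemma eq_cont0 f g : eq0inf f g -> cont0 f -> cont0 g.
Proof.
move=> fg; apply: subspace_eq_continuous => x.
by rewrite inE/= in_itv/= andbT => /fg.
Qed.

Lemma eq_decays f g : eq0inf f g -> decays f -> decays g.
Proof.
move=> fg /decaysP df; apply/decaysP => e /df[T T0 Tf]; exists T => // t Tt.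
by rewrite -fg ?Tf// (le_trans T0).
Qed.

Lemma eq_inY f g : eq0inf f g -> inY f -> inY g.
Proof. by move=> fg [/(eq_cont0 fg) cf /(eq_decays fg) df]. Qed.

(** The shape [a * f + g] covers sums, differences ([a = -1]) and multiples ([g = 0]); hence the
    terms [-1 * _] and [_ + 0] met in later proofs. *)
Lemma cont0_lin a f g : cont0 f -> cont0 g -> cont0 (fun t => a * f t + g t).
Proof.
move=> cf cg x; apply: cvgD; last exact: cg.
by apply: cvgM; [exact: cvg_cst|exact: cf].
Qed.

Lemma decays_lin a f g : decays f -> decays g -> decays (fun t => a * f t + g t).
Proof.
rewrite /decays => df dg.
have -> : (fun t => expR t * (a * f t + g t)) =
  (fun t => a * (expR t * f t) + expR t * g t) by apply/funext => t; ring.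
by rewrite -(addr0 0) -{1}(mulr0 a); apply: cvgD => //; apply: cvgM => //; exact: cvg_cst.
Qed.

Lemma inY_lin a f g : inY f -> inY g -> inY (fun t => a * f t + g t).
Proof. by move=> [? ?] [? ?]; split; [exact: cont0_lin|exact: decays_lin]. Qed.

Lemma inY0 : inY (fun=> 0 : R).
Proof.
split; first by move=> x; exact: cvg_cst.
by apply/decaysP => e e0; exists 0 => // t _; rewrite normr0 mulr0 ltW.
Qed.

Lemma inYB f g : inY f -> inY g -> inY (fun t => f t - g t).
Proof.
by move=> fY gY; apply: (eq_inY _ (inY_lin (-1) gY fY)) => t _; ring.
Qed.

Lemma inYM f g : inY f -> inY g -> inY (fun t => f t * g t).
Proof.
move=> fY gY; have [cf _] := fY; have [cg /decaysP dg] := gY; split.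
  by move=> x; apply: cvgM; [exact: cf|exact: cg].
apply/decaysP => e e0.
have e1 : 0 < e / (1 + wsup f) by rewrite divr_gt0// ltr_wpDr// wsup_ge0.
have [T T0 Tg] := dg _ e1; exists T => // t Tt.
have t0 := le_trans T0 Tt.
have f0 := wsup_ge0 f.
have -> : e = (1 + wsup f) * (e / (1 + wsup f)).
  by rewrite mulrC divfK// lt0r_neq0//; lra.
rewrite normrM mulrCA; apply: ler_pM => //; rewrite ?mulr_ge0 ?expR_ge0//.
  by apply: (le_trans (norm_le_wsup fY t0)); lra.
exact: Tg.
Qed.

Lemma wsup_lin a f g : inY f -> inY g ->
  wsup (fun t => a * f t + g t) <= `|a| * wsup f + wsup g.
Proof.
move=> fY gY; apply: wsup_le => t t0.
have := le_wsup fY t0; have := le_wsup gY t0.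
have := ler_normD (a * f t) (g t); rewrite normrM => h1 h2 h3.
apply: (@le_trans _ _ (expR t * (`|a| * `|f t| + `|g t|))).
  by rewrite ler_pM2l ?expR_gt0.
by rewrite mulrDr lerD// mulrCA ler_wpM2l.
Qed.

(** The weight is spent on [f]; for [g] the unweighted bound suffices, as [expR t >= 1] on the
    half-line. *)
Lemma wsupM f g : inY f -> inY g -> wsup (fun t => f t * g t) <= wsup f * wsup g.
Proof.
move=> fY gY; apply: wsup_le => t t0.
rewrite normrM mulrA; apply: ler_pM => //; rewrite ?mulr_ge0 ?expR_ge0//.
  exact: le_wsup.
exact: norm_le_wsup.
Qed.

Lemma wsup_eq0 f : inY f -> wsup f <= 0 -> eq0inf f (fun=> 0).
Proof.
move=> fY f0 t t0; have := le_wsup fY t0; apply: contraTeq => ft.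
by rewrite -ltNge (le_lt_trans f0)// mulr_gt0 ?expR_gt0 ?normr_gt0.
Qed.

End WeightedSup.

Lemma cvg_congr (T : Type) (U : nbhsType) (F : set_system T) {FF : Filter F} (f g : T -> U)
    (l : U) :
  {near F, f =1 g} -> f @ F --> l -> g @ F --> l.
Proof. by move=> fg; apply: cvg_trans; exact: near_eq_cvg fg. Qed.

(** * Derivatives on the half-line and comparison of increments *)

Section HalfLineDerivative.
Variable R : realType.
Implicit Types (f g : R -> R) (a m t T : R).

(** A relation with a proposed derivative, so that explicit formulas can be used directly;
    [is_dR_dR] and [C1_is_dR] link it to [dR]. *)
Definition is_dR f f' := (forall t, 0 < t -> is_derive t 1 f (f' t)) /\
  (f s - f 0) / s @[s --> 0^'+] --> f' 0.

Lemma is_dR_dR f f' : is_dR f f' -> eq0inf (dR f) f'.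
Proof.
move=> [df d0] t; rewrite le_eqVlt => /predU1P[<-|t0]; rewrite /dR.
  by rewrite eqxx; apply/cvg_lim.
by rewrite gt_eqF// derive1E; have [_ ->] := df t t0.
Qed.

Lemma C1_is_dR f : C1_0inf f -> is_dR f (dR f).
Proof.
move=> [df c0 _ _]; split=> [t t0|]; last by rewrite /dR eqxx.
rewrite /dR (gt_eqF t0) derive1E; exact: derivableP (df t t0).
Qed.

Lemma is_dR_cont f f' : is_dR f f' -> cont0 f.
Proof.
move=> [df d0]; apply/continuous_within_itvcyP; split.
  move=> t; rewrite in_itv/= andbT => /df [dft _].
  exact/differentiable_continuous/derivable1_diffP.
have h : (f s - f 0) / s * s + f 0 @[s --> 0^'+] --> f' 0 * 0 + f 0.
  apply: cvgD; last exact: cvg_cst.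
  by apply: cvgM => //; apply: cvg_at_right_filter; exact: cvg_id.
rewrite mulr0 add0r in h.
apply: (cvg_congr _ h); near=> s.
by rewrite divfK ?subrK// gt_eqF//; near: s; exact: nbhs_right_gt.
Unshelve. all: by end_near. Qed.

Lemma eq_is_dR f g f' g' : eq0inf f g -> eq0inf f' g' -> is_dR f f' -> is_dR g g'.
Proof.
move=> fg fg' [df d0]; split=> [t t0|].
  have [dft dfE] := df t t0.
  have nfg : {near t, f =1 g}.
    near=> s; apply: fg; apply: ltW; near: s; exact: lt_nbhsr.
  split; first exact: near_eq_derivable dft.
  by rewrite -(near_eq_derive _ nfg) dfE fg'// ltW.
rewrite -fg' -?fg//; apply: (cvg_congr _ d0); near=> s.
by rewrite fg//; apply: ltW; near: s; exact: nbhs_right_gt.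
Unshelve. all: by end_near. Qed.

Lemma is_dR_lin a f f' g g' : is_dR f f' -> is_dR g g' ->
  is_dR (fun t => a * f t + g t) (fun t => a * f' t + g' t).
Proof.
move=> [df d0] [dg e0]; split=> [t t0|].
  have dft := df t t0; have dgt := dg t t0.
  exact: (is_deriveD (is_deriveZ a dft) dgt).
have -> : (fun s => (a * f s + g s - (a * f 0 + g 0)) / s) =
   (fun s => a * ((f s - f 0) / s) + (g s - g 0) / s) by apply/funext => s; ring.
by apply: cvgD => //; apply: cvgM => //; exact: cvg_cst.
Qed.

Lemma is_derive_is_dR f f' : (forall t, 0 <= t -> is_derive t 1 f (f' t)) -> is_dR f f'.
Proof.
move=> df; split=> [t /ltW/df//|].
have [d0 dE] := df 0 (lexx 0).
apply: cvg_dnbhs_at_right; rewrite -dE.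
have h : (fun s => s^-1 *: (f (s *: 1 + 0) - f 0)) @ 0^' --> 'D_1 f 0 := d0.
apply: (cvg_congr _ h); near=> s.
by rewrite addr0 [s *: 1]mulr1 mulrC.
Unshelve. all: by end_near. Qed.

Lemma is_dR_C1 f f' : is_dR f f' -> cont0 f' -> C1_0inf f.
Proof.
move=> ff' cf'; split.
- by move=> t t0; have [] := ff'.1 t t0.
- by apply/cvg_ex; exists (f' 0); exact: ff'.2.
- exact: is_dR_cont ff'.
- by apply: eq_cont0 cf' => t /(is_dR_dR ff') ->.
Qed.

(* Monotonicity of [g - f] and [g + f]. *)
Lemma increment_le T f f' g g' : 0 <= T -> cont0 f -> cont0 g ->
  (forall t, T < t -> is_derive t 1 f (f' t)) ->
  (forall t, T < t -> is_derive t 1 g (g' t)) ->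
  (forall t, T < t -> `|f' t| <= g' t) ->
  forall s t, T <= s -> s <= t -> `|f t - f s| <= g t - g s.
Proof.
move=> T0 cf cg df dg fg s t Ts; rewrite le_eqVlt => /predU1P[<-|st].
  by rewrite !subrr normr0.
have sub : [set` `[s, t]] `<=` [set` `[0, +oo[].
  move=> x /=; rewrite !in_itv/= andbT => /andP[sx _].
  exact: le_trans (le_trans T0 Ts) sx.
have key c : `|c| = 1 -> c * (f t - f s) <= g t - g s.
  move=> c1.
  have dh x : x \in `]s, t[ ->
      is_derive x 1 (fun x => - c * f x + g x) (- c * f' x + g' x).
    rewrite in_itv/= => /andP[sx _]; have Tx := le_lt_trans Ts sx.
    have dfx := df x Tx; have dgx := dg x Tx.
    exact: (is_deriveD (is_deriveZ (- c) dfx) dgx).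
  have ch : {within `[s, t], continuous (fun x => - c * f x + g x)}.
    by apply: continuous_subspaceW sub _; exact: cont0_lin.
  have [x] := MVT st dh ch; rewrite in_itv/= => /andP[sx xt] E.
  have := fg x (le_lt_trans Ts sx) => fgx.
  have : c * f' x <= g' x.
    by apply: le_trans fgx; rewrite -[leRHS]mul1r -c1 -normrM ler_norm.
  move=> cfg.
  have : 0 <= (- c * f' x + g' x) * (t - s).
    by rewrite mulr_ge0 ?subr_ge0 ?(ltW st)//; lra.
  by rewrite -E; lra.
have := key 1 (normr1 _); have := key (-1) (normrN1 _).
by rewrite ler_norml; lra.
Qed.

End HalfLineDerivative.

(** * Integrating factors and bounds for the two first-order equations *)

Section Antiderivative.
Variable R : realType.
Implicit Types (f y v z P : R -> R) (a c m t T : R).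

(** Extension by the constant [f 0] to the left turns continuity on the half-line into continuity on
    the line. *)
Lemma cont0_extend f : cont0 f -> continuous (fun t => f (Num.max t 0)).
Proof.
move=> /subspace_continuousP cf t.
have t0 : [set` `[0, +oo[] (Num.max t 0) by rewrite /= in_itv/= andbT le_max lexx orbT.
have cm : Num.max s 0 @[s --> t] --> Num.max t 0.
  by apply: continuous_max; [exact: cvg_id|exact: cvg_cst].
apply/cvgrPdist_le => e e0; have /cvgrPdist_le/(_ e e0) := cf _ t0.
rewrite near_withinE => /cm cfe.
have {}cfe : \forall s \near t, [set` `[0, +oo[] (Num.max s 0) ->
    `|f (Num.max t 0) - f (Num.max s 0)| <= e by exact: cfe.
near=> s; apply: (near cfe s) => //=.
by rewrite in_itv/= andbT le_max lexx orbT.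
Unshelve. all: by end_near. Qed.

Lemma antiderivative f : cont0 f -> exists F,
  forall t, 0 <= t -> is_derive t 1 F (f t).
Proof.
move=> /cont0_extend ce; set e := fun _ => _ in ce.
(* The base point -1 puts 0 in the interior, so the derivative at 0 is two-sided. *)
exists (fun x => \int[lebesgue_measure]_(s in `[-1, x]) e s) => t t0.
have ie : lebesgue_measure.-integrable `[-1, t + 1] (EFin \o e).
  apply: continuous_compact_integrable; first exact: segment_compact.
  exact: continuous_subspaceT.
have lt1 : -1 < t by lra.
have tt1 : t < t + 1 by rewrite ltrDl.
have [d dE] := continuous_FTC1_closed tt1 ie lt1 (ce t).
have -> : f t = e t by rewrite /e; congr f; apply/esym/max_idPl.
by rewrite -dE derive1E; exact: derivableP.
Qed.

Lemma is_derive_expM c (x : R) f (d : R) : is_derive x 1 f d ->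
  is_derive x 1 (fun t => expR (c * t) * f t) (expR (c * x) * (d + c * f x)).
Proof.
move=> df.
have dl : is_derive x 1 (fun t : R => c * t) c.
  by apply: is_derive_eq (is_deriveZ c (is_derive_id x 1)) _; rewrite [LHS]mulr1.
have de : is_derive x 1 (fun t => expR (c * t)) (expR (c * x) * c).
  exact: (is_derive1_comp (is_derive_expR _) dl).
apply: is_derive_eq (is_deriveM de df) _.
by rewrite /= ![_ *: _]mulrC; ring.
Qed.

Lemma is_derive_exp c (x : R) a :
  is_derive x 1 (fun t : R => a * expR (c * t)) (a * c * expR (c * x)).
Proof.
have h := is_derive_expM c (is_derive_cst a x 1).
have -> : (fun t => a * expR (c * t)) = (fun t => expR (c * t) * cst a t).
  by apply/funext => t; rewrite mulrC.
by apply: is_derive_eq h _; rewrite /=; ring.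
Qed.

Lemma cont0_derive f f' : (forall t, 0 <= t -> is_derive t 1 f (f' t)) -> cont0 f.
Proof. by move=> df; apply: (@is_dR_cont _ _ f'); exact: is_derive_is_dR. Qed.

Lemma cont0_expM c f : cont0 f -> cont0 (fun t => expR (c * t) * f t).
Proof.
move=> cf x; apply: cvgM; last exact: cf.
apply: (@cont0_derive (fun t => expR (c * t)) (fun t => c * expR (c * t))).
move=> t _; have := is_derive_exp c t 1; rewrite mul1r.
by under eq_fun do rewrite mul1r.
Qed.

(* Integrate [(e^(-a t) v)' = - e^(-a t) y] from [t] to infinity. *)
Lemma unstable_bound a m T v v' y : 0 <= a -> 0 <= T -> is_dR v v' ->
  (forall t, 0 <= t -> v' t = a * v t - y t) ->
  (forall t, T <= t -> expR t * `|y t| <= m) ->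
  expR (- a * t) * v t @[t --> +oo] --> 0 ->
  forall t, T <= t -> expR t * `|v t| <= m.
Proof.
move=> a0 T0 dv vE ym lv s Ts.
have m0 : 0 <= m by apply: le_trans (ym s Ts); rewrite mulr_ge0 ?expR_ge0.
pose f t := expR (- a * t) * v t.
(* An antiderivative of the bound [m e^(-(a + 1) t)] on the derivative of [f], tending to 0 at
   infinity. *)
pose g t := - (m / (a + 1)) * expR (- (a + 1) * t).
have df t : T < t -> is_derive t 1 f (expR (- a * t) * - y t).
  move=> Tt; have t0 := le_lt_trans T0 Tt.
  apply: is_derive_eq (is_derive_expM (- a) (dv.1 t t0)) _.
  by rewrite vE ?(ltW t0)//; ring.
have dg t : is_derive t 1 g (m * expR (- (a + 1) * t)).
  apply: is_derive_eq (is_derive_exp _ _ _) _.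
  by rewrite mulrNN divfK// gt_eqF// ltr_wpDl.
have cf : cont0 f by apply: cont0_expM; exact: is_dR_cont dv.
have cg : cont0 g by apply: cont0_derive => t _; exact: dg.
have fg t : T < t -> `|expR (- a * t) * - y t| <= m * expR (- (a + 1) * t).
  move=> Tt; rewrite normrM normrN gtr0_norm ?expR_gt0//.
  have -> : - (a + 1) * t = - a * t - t by ring.
  rewrite expRD mulrCA ler_pM2l ?expR_gt0// expRN -ler_pdivrMr ?invr_gt0 ?expR_gt0//.
  by rewrite invrK mulrC ym// ltW.
have incr := increment_le T0 cf cg df (fun t _ => dg t) fg.
have fs : `|f s| <= - g s.
  have lf : `|f s| - `|f t| @[t --> +oo] --> `|f s| - `|0 : R|.
    by apply: cvgB; [exact: cvg_cst|apply: cvg_norm; exact: lv].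
  rewrite normr0 subr0 in lf.
  apply: (cvgr_to_le lf); near=> t.
  have st : s <= t by near: t; apply: nbhs_pinfty_ge; exact: num_real.
  have := incr s t Ts st.
  have : `|f s| - `|f t| <= `|f t - f s| by rewrite distrC lerB_dist.
  have : g t <= 0 by rewrite /g mulNr oppr_le0 mulr_ge0 ?expR_ge0 ?divr_ge0//; lra.
  lra.
have : m / (a + 1) <= m by rewrite ler_pdivrMr ?ltr_wpDl// ler_peMr//; lra.
apply: le_trans; move: fs.
have -> : - g s = expR (- a * s) * (m / (a + 1) / expR s).
  rewrite /g; have -> : - (a + 1) * s = - a * s + - s by ring.
  by rewrite expRD expRN; ring.
rewrite /f normrM (gtr0_norm (expR_gt0 _)) ler_pM2l ?expR_gt0//.
by rewrite ler_pdivlMr ?expR_gt0// mulrC.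
Unshelve. all: by end_near. Qed.

(* Integrate [(e^(2 t) z)' = e^(2 t) v] from [T] to [t]. *)
Lemma stable_bound m T z z' v : 0 <= T -> is_dR z z' ->
  (forall t, 0 <= t -> z' t = v t - 2 * z t) ->
  (forall t, T <= t -> expR t * `|v t| <= m) ->
  forall t, T <= t -> expR t * `|z t| <= expR (- t) * (expR (2 * T) * `|z T|) + m.
Proof.
move=> T0 dz zE vm s Ts.
have m0 : 0 <= m by apply: le_trans (vm s Ts); rewrite mulr_ge0 ?expR_ge0.
pose f t := expR (2 * t) * z t.
pose g t := m * expR (1 * t).
have df t : T < t -> is_derive t 1 f (expR (2 * t) * v t).
  move=> Tt; have t0 := le_lt_trans T0 Tt.
  apply: is_derive_eq (is_derive_expM 2 (dz.1 t t0)) _.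
  by rewrite zE ?(ltW t0)//; ring.
have dg t : is_derive t 1 g (m * expR t).
  by apply: is_derive_eq (is_derive_exp _ _ _) _; rewrite mulr1 mul1r.
have cf : cont0 f by apply: cont0_expM; exact: is_dR_cont dz.
have cg : cont0 g by apply: cont0_derive => t _; exact: dg.
have e2 t : expR (2 * t) = expR t * expR t by rewrite -expRD; congr expR; ring.
have fg t : T < t -> `|expR (2 * t) * v t| <= m * expR t.
  move=> Tt; rewrite normrM gtr0_norm ?expR_gt0// e2 -mulrA mulrC.
  by rewrite ler_pM2r ?expR_gt0// vm// ltW.
have := increment_le T0 cf cg df (fun t _ => dg t) fg (lexx T) Ts.
have := lerB_dist (f s) (f T).
have : 0 <= g T by rewrite mulr_ge0 ?expR_ge0.
rewrite /f /g !normrM !(gtr0_norm (expR_gt0 _)) mul1r => h1 h2 h3.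
rewrite -(ler_pM2l (expR_gt0 s)) mulrDr expRN mulVKf ?gt_eqF ?expR_gt0//.
rewrite mulrA -e2; move: h1 h2 h3; rewrite !mul1r; lra.
Qed.

End Antiderivative.

(** * The linear part as a bounded operator from [X] to [Y] *)

Section LinearOperator.
Variables (R : realType) (N : nat) (b : bcond).
Implicit Types (f y v z P : R -> R) (a c m t T : R).

Definition linop z : R -> R := fun t =>
  - dR (dR z) t + (N%:R - 4) * dR z t + (2 * N%:R - 4) * z t.

Lemma inX_is_dR z : inX N b z ->
  [/\ is_dR z (dR z), is_dR (dR z) (dR (dR z)), inY z, inY (dR z) & inY (dR (dR z))].
Proof.
move=> [[cz cdz] _ d0 d1 d2].
by split; [exact: C1_is_dR|exact: C1_is_dR|split => //; case: cz|
  split => //; case: cdz|split => //; case: cdz].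
Qed.

(** Builds members of [X] from explicit derivatives. Since [dR z] agrees with [z1] only on the
    half-line, the second derivative is transferred along that agreement by [eq_is_dR]. *)
Lemma is_dR_inX z z1 z2 : is_dR z z1 -> is_dR z1 z2 -> inY z -> inY z1 -> inY z2 ->
  match b with Dirichlet => z 0 = 0 | Navier => z1 0 - (N%:R - 2) * z 0 = 0 end ->
  [/\ inX N b z, eq0inf (dR z) z1 & eq0inf (dR (dR z)) z2].
Proof.
move=> h1 h2 zY z1Y z2Y bc.
have e1 := is_dR_dR h1.
have e1' : eq0inf z1 (dR z) by move=> t /e1.
have h2' : is_dR (dR z) z2 by apply: (eq_is_dR _ _ h2).
have e2 := is_dR_dR h2'.
have e2' : eq0inf z2 (dR (dR z)) by move=> t /e2.
split => //; split.
- by split; [apply: is_dR_C1 h1 _; case: z1Y|apply: is_dR_C1 h2' _; case: z2Y].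
- by move: bc; rewrite /bc_holds; case: b => //; rewrite e1.
- by case: zY.
- by apply: eq_decays e1' _; case: z1Y.
- by apply: eq_decays e2' _; case: z2Y.
Qed.

Lemma inX_lin a z w : inX N b z -> inX N b w ->
  [/\ inX N b (fun t => a * z t + w t),
      eq0inf (dR (fun t => a * z t + w t)) (fun t => a * dR z t + dR w t) &
      eq0inf (dR (dR (fun t => a * z t + w t)))
             (fun t => a * dR (dR z) t + dR (dR w) t)].
Proof.
move=> zX wX; have [z1 z2 ? ? ?] := inX_is_dR zX; have [w1 w2 ? ? ?] := inX_is_dR wX.
apply: is_dR_inX; [exact: is_dR_lin|exact: is_dR_lin|exact: inY_lin|exact: inY_lin|exact: inY_lin|].
have [_ bz _ _ _] := zX; have [_ bw _ _ _] := wX; move: bz bw.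
rewrite /bc_holds; case: b => [-> ->|bz bw]; first by rewrite mulr0 addr0.
have -> : a * dR z 0 + dR w 0 - (N%:R - 2) * (a * z 0 + w 0) =
  a * (dR z 0 - (N%:R - 2) * z 0) + (dR w 0 - (N%:R - 2) * w 0) by ring.
by rewrite bz bw mulr0 addr0.
Qed.

Lemma linop_lin a z w : inX N b z -> inX N b w ->
  eq0inf (linop (fun t => a * z t + w t)) (fun t => a * linop z t + linop w t).
Proof.
move=> zX wX t t0; have [_ e1 e2] := inX_lin a zX wX.
rewrite /linop (e1 t t0) (e2 t t0).
move: (dR (dR z) t) (dR (dR w) t) (dR z t) (dR w t) (z t) (w t) (N%:R : R).
by move=> *; ring.
Qed.

Lemma linopE z t : linop z t =
  -1 * dR (dR z) t + ((N%:R - 4) * dR z t + (2 * N%:R - 4) * z t).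
Proof. by rewrite /linop mulN1r addrA. Qed.

Lemma inY_linop z : inX N b z -> inY (linop z).
Proof.
move=> /inX_is_dR[_ _ zY z1Y z2Y].
have zcY : inY (fun t => (2 * N%:R - 4) * z t).
  by apply: (@eq_inY _ (fun t => (2 * N%:R - 4) * z t + 0));
    [move=> t _; rewrite addr0|exact: inY_lin zY (@inY0 R)].
by apply: eq_inY (inY_lin (-1) z2Y (inY_lin _ z1Y zcY)) => t _; rewrite linopE.
Qed.

Lemma wsup_le_Xnorm z : wsup z <= Xnorm z.
Proof. by rewrite /Xnorm -addrA lerDl addr_ge0// wsup_ge0. Qed.

Lemma Xnorm_ge0 z : 0 <= Xnorm z.
Proof. exact: le_trans (wsup_ge0 z) (wsup_le_Xnorm z). Qed.

(** Boundedness of the linear part: through it the preimage of a ball of [Y] contains a ball of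
    [X]. *)
Lemma wsup_linop_le z : inX N b z ->
  wsup (linop z) <= (1 + `|N%:R - 4| + `|2 * N%:R - 4|) * Xnorm z.
Proof.
move=> /inX_is_dR[_ _ zY z1Y z2Y].
have n0 := wsup_ge0 z; have n1 := wsup_ge0 (dR z); have n2 := wsup_ge0 (dR (dR z)).
apply: wsup_le => t t0.
have h0 := le_wsup zY t0; have h1 := le_wsup z1Y t0; have h2 := le_wsup z2Y t0.
rewrite linopE /Xnorm; move: n0 n1 n2 h0 h1 h2 (expR_ge0 t).
move: (wsup z) (wsup (dR z)) (wsup (dR (dR z))) (z t) (dR z t) (dR (dR z) t).
move: (N%:R - 4) (2 * N%:R - 4) (expR t) => p q e w0 w1 w2 x0 x1 x2.
move=> n0 n1 n2 h0 h1 h2 e0.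
apply: (@le_trans _ _ (e * (`|x2| + (`|p| * `|x1| + `|q| * `|x0|)))).
  apply: ler_wpM2l => //; rewrite mulN1r -!normrM -[`|x2|]normrN.
  by apply: (le_trans (ler_normD _ _)); rewrite lerD2l ler_normD.
have p0 := normr_ge0 p; have q0 := normr_ge0 q.
have k1 := ler_wpM2l p0 h1; have k2 := ler_wpM2l q0 h0.
have j1 := mulr_ge0 p0 n0; have j2 := mulr_ge0 p0 n2.
have j3 := mulr_ge0 q0 n1; have j4 := mulr_ge0 q0 n2.
lra.
Qed.

End LinearOperator.

(** * The a priori bound for the inverse of the linear part *)

Section APriori.
Variable R : realType.
Implicit Types (y v z : R -> R) (a m t : R).

(* [z'' - (a - 2) z' - 2 a z = (D - a) (D + 2) z], and both boundary conditions
   bound [z 0] by the value of [v = (D + 2) z] at [0]. *)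
Lemma solution_bound b a m z z1 z2 y : 0 <= a -> is_dR z z1 -> is_dR z1 z2 ->
  inY z -> inY z1 ->
  (forall t, 0 <= t -> z2 t = - y t + (a - 2) * z1 t + 2 * a * z t) ->
  match b with Dirichlet => z 0 = 0 | Navier => z1 0 - a * z 0 = 0 end ->
  (forall t, 0 <= t -> expR t * `|y t| <= m) ->
  forall t, 0 <= t -> [/\ expR t * `|z t| <= 2 * m, expR t * `|z1 t| <= 5 * m &
    expR t * `|z2 t| <= (11 + 9 * a) * m].
Proof.
move=> a0 h1 h2 zY z1Y z2E bc ym.
pose v t := 2 * z t + z1 t.
have vY : inY v by exact: inY_lin.
have vm t : 0 <= t -> expR t * `|v t| <= m.
  apply: (unstable_bound (y := y) a0 (lexx 0) (is_dR_lin 2 h1 h2)) => //.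
    move=> s s0; rewrite (z2E s s0).
    by rewrite /=; move: (z s) (z1 s) (y s) => x0 x1 x2; ring.
  (* As [e^(-a s) <= e^s] for [s >= 0], the decay of [v] implies the weaker limit that excludes
     [e^(a t)]. *)
  apply/cvgrPdist_le => e e0; have [_ /decaysP /(_ e e0)[T T0 Te]] := vY.
  near=> s; rewrite sub0r normrN normrM gtr0_norm ?expR_gt0//.
  have Ts : T <= s by near: s; apply: nbhs_pinfty_ge; exact: num_real.
  apply: (le_trans _ (Te s Ts)); apply: ler_wpM2r => //.
  by rewrite ler_expR; have := mulr_ge0 a0 (le_trans T0 Ts); lra.
have v0m : `|v 0| <= m by have := vm 0 (lexx 0); rewrite expR0 mul1r.
have m0 : 0 <= m by exact: le_trans v0m.
have z0m : `|z 0| <= m.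
  move: bc; case: b => [->|bz]; first by rewrite normr0.
  have vE : v 0 = (a + 2) * z 0 by rewrite /v; lra.
  apply: (le_trans _ v0m); rewrite vE normrM ler_peMl//.
  by rewrite ger0_norm; lra.
have zm t : 0 <= t -> expR t * `|z t| <= 2 * m.
  move=> t0; have zE s : 0 <= s -> z1 s = v s - 2 * z s by rewrite /v => _; ring.
  have := stable_bound (lexx 0) h1 zE vm t0.
  have e1 : expR (- t) <= 1 by rewrite -expR0 ler_expR oppr_le0.
  rewrite mulr0 expR0 mul1r.
  have : expR (- t) * `|z 0| <= m.
    by apply: (le_trans _ z0m); rewrite ler_piMl.
  lra.
have z1m t : 0 <= t -> expR t * `|z1 t| <= 5 * m.
  move=> t0; have := vm t t0; have := zm t t0.
  have : `|z1 t| <= `|v t| + 2 * `|z t|.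
    have -> : z1 t = v t - 2 * z t by rewrite /v; ring.
    by apply: (le_trans (ler_normB _ _)); rewrite normrM ger0_norm.
  rewrite -(ler_pM2l (expR_gt0 t)); lra.
move=> t t0; split; [exact: zm|exact: z1m|].
have h := ym t t0; have hz1 := z1m t t0; have hz := zm t t0.
(* Here [|a - 2| <= a + 2] since [a >= 0]; with the bounds on [z] and [z1] the constant becomes
   [1 + 5 (a + 2) + 4 a = 11 + 9 a]. *)
have : `|z2 t| <= `|y t| + (a + 2) * `|z1 t| + 2 * a * `|z t|.
  rewrite (z2E t t0); apply: (le_trans (ler_normD _ _)); apply: lerD; last first.
    by rewrite normrM ger0_norm// mulr_ge0.
  apply: (le_trans (ler_normD _ _)); rewrite normrN lerD2l normrM ler_wpM2r//.
  by rewrite ler_norml; apply/andP; split; lra.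
rewrite -(ler_pM2l (expR_gt0 t)) => /le_trans; apply.
have k1 : (a + 2) * (expR t * `|z1 t|) <= (a + 2) * (5 * m).
  by rewrite ler_wpM2l//; lra.
have k2 : 2 * a * (expR t * `|z t|) <= 2 * a * (2 * m).
  by rewrite ler_wpM2l// mulr_ge0.
lra.
Unshelve. all: by end_near. Qed.

(** [solution_bound] with [a = N - 2]: the constants 2, 5 and [11 + 9 (N - 2)] add up to exactly
    [9 N]. *)
Lemma Xnorm_le N b z : (2 <= N)%N -> inX N b z ->
  Xnorm z <= 9 * N%:R * wsup (linop N z).
Proof.
move=> N2 zX; have [h1 h2 zY z1Y z2Y] := inX_is_dR zX.
have yY := inY_linop zX.
have a0 : 0 <= N%:R - 2 :> R by rewrite subr_ge0 ler_nat.
have [_ bz _ _ _] := zX.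
have zE t : 0 <= t -> dR (dR z) t =
    - linop N z t + (N%:R - 2 - 2) * dR z t + 2 * (N%:R - 2) * z t.
  rewrite /linop; move: (dR (dR z) t) (dR z t) (z t) (N%:R : R) => x2 x1 x0 n _.
  ring.
have H := solution_bound a0 h1 h2 zY z1Y zE bz (le_wsup yY).
rewrite /Xnorm; set m := wsup (linop N z) in H *.
have -> : 9 * N%:R * m = 2 * m + 5 * m + (11 + 9 * (N%:R - 2)) * m.
  by move: m (N%:R : R) {H} => m n; ring.
by rewrite !lerD//; apply: wsup_le => t /H[].
Qed.

End APriori.

(** * Solving the linear equation, one first-order factor at a time *)

Section Existence.
Variable R : realType.
Implicit Types (y v z P p : R -> R) (a c m t : R).

(** [P - m e^(-t)] is nondecreasing and bounded above on the half-line, so it converges, and the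
    correction tends to 0. *)
Lemma cvg_exp_increments P p m : (forall t, 0 <= t -> is_derive t 1 P (p t)) ->
  (forall t, 0 <= t -> expR t * `|p t| <= m) -> exists l : R, P t @[t --> +oo] --> l.
Proof.
move=> dP pm.
have m0 : 0 <= m by apply: le_trans (pm 0 (lexx 0)); rewrite mulr_ge0 ?expR_ge0.
pose g t := - m * expR (-1 * t).
have dg t : is_derive t 1 g (m * expR (- t)).
  by apply: is_derive_eq (is_derive_exp _ _ _) _; rewrite mulNr mulrN1 opprK mulN1r.
have cg : cont0 g by apply: cont0_derive => t _; exact: dg.
have cP := cont0_derive dP.
have dPg t : 0 < t -> `|p t| <= m * expR (- t).
  by move=> /ltW t0; rewrite expRN ler_pdivlMr ?expR_gt0// mulrC pm.
have incr := increment_le (lexx 0) cP cg (fun t ht => dP t (ltW ht)) (fun t _ => dg t) dPg.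
pose h t := P (Num.max t 0) + g (Num.max t 0).
have max0 t : 0 <= Num.max t 0 :> R by rewrite le_max lexx orbT.
have g0 t : g t <= 0 by rewrite /g mulr_le0_ge0 ?oppr_le0 ?expR_ge0.
have hnd : {homo h : s t / s <= t}.
  move=> s t st; have := incr (Num.max s 0) (Num.max t 0) (max0 s).
  rewrite ge_max !le_max st lexx !orbT/= => /(_ isT).
  by rewrite ler_norml /h => /andP[? _]; lra.
have hub : has_ubound (range h).
  exists (P 0 - g 0) => _ [t _ <-]; have := incr 0 (Num.max t 0) (lexx 0) (max0 t).
  by have := g0 (Num.max t 0); rewrite ler_norml /h => ? /andP[_ ?]; lra.
exists (sup (range h)).
have hc := nondecreasing_cvgr hnd hub.
have gc : g t @[t --> +oo] --> - m * 0.
  rewrite /g; under eq_fun do rewrite mulN1r.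
  by apply: cvgM; [exact: cvg_cst|exact: cvgr_expR].
have hg : h t - g t @[t --> +oo] --> sup (range h) - - m * 0 by exact: cvgB.
rewrite mulr0 subr0 in hg.
apply: (cvg_congr _ hg); near=> t.
have t0 : 0 <= t by near: t; apply: nbhs_pinfty_ge; exact: num_real.
by rewrite /h (max_idPl t0) /= addrK.
Unshelve. all: by end_near. Qed.

Lemma unstable_solution a y : 0 <= a -> inY y ->
  exists2 v, is_dR v (fun t => a * v t - y t) & inY v.
Proof.
move=> a0 yY; have [cy /decaysP dy] := yY.
have [P dP] := antiderivative (cont0_expM (c := - a) cy).
have [l Pl] : exists l : R, P t @[t --> +oo] --> l.
  apply: (cvg_exp_increments dP) => t t0; apply: (le_trans _ (le_wsup yY t0)).
  rewrite normrM (gtr0_norm (expR_gt0 _)); apply: ler_wpM2l; first exact: expR_ge0.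
  rewrite ler_piMl// -expR0 ler_expR mulNr oppr_le0 mulr_ge0//.
(* This is [v(t) = \int_t^oo e^(a (t - s)) y(s) ds]: the constant [l] is the one for which
   [e^(-a t) v] tends to 0. *)
pose v t := expR (a * t) * (l - P t).
have dv : is_dR v (fun t => a * v t - y t).
  apply: is_derive_is_dR => t t0.
  have dlP : is_derive t 1 (fun s => l - P s) (0 - expR (- a * t) * y t).
    exact: is_deriveB (is_derive_cst l t 1) (dP t t0).
  apply: is_derive_eq (is_derive_expM a dlP) _.
  have ee : expR (a * t) * expR (- a * t) = 1 by rewrite mulNr expRN divff// gt_eqF ?expR_gt0.
  rewrite /v; move: (expR (a * t)) (expR (- a * t)) (P t) (y t) ee => e e' p u ee.
  have -> : e * (0 - e' * u + a * (l - p)) = a * (e * (l - p)) - e * e' * u by ring.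
  by rewrite ee mul1r.
have lv : expR (- a * t) * v t @[t --> +oo] --> 0.
  have h : l - P t @[t --> +oo] --> l - l by apply: cvgB; [exact: cvg_cst|].
  rewrite subrr in h; have <- : (fun t => l - P t) = (fun t => expR (- a * t) * v t).
    by apply/funext => t; rewrite /v mulNr expRN mulKf// gt_eqF ?expR_gt0.
  exact: h.
exists v => //; split; first exact: is_dR_cont dv.
(* The bound started at [T], with [e] in place of the norm of [y], is the decay of [v]. *)
apply/decaysP => e e0; have [T T0 Te] := dy e e0; exists T => //.
exact: unstable_bound a0 T0 dv (fun t _ => erefl) Te lv.
Qed.

(** Every solution decays, because [e^(-2 t)] beats the weight [e^t]; the value [c] at 0 stays free
    for the boundary condition. *)
Lemma stable_solution v c : inY v ->
  exists2 z, is_dR z (fun t => v t - 2 * z t) & inY z /\ z 0 = c.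
Proof.
move=> [cv /decaysP dv].
have [Q dQ] := antiderivative (cont0_expM (c := 2) cv).
pose z t := expR (-2 * t) * (Q t - (Q 0 - c)).
have dz : is_dR z (fun t => v t - 2 * z t).
  apply: is_derive_is_dR => t t0.
  have dlQ : is_derive t 1 (fun s => Q s - (Q 0 - c)) (expR (2 * t) * v t - 0).
    exact: is_deriveB (dQ t t0) (is_derive_cst (Q 0 - c) t 1).
  apply: is_derive_eq (is_derive_expM (-2) dlQ) _.
  have ee : expR (-2 * t) * expR (2 * t) = 1 by rewrite mulNr expRN mulVf// gt_eqF ?expR_gt0.
  rewrite /z; move: (expR (-2 * t)) (expR (2 * t)) (Q t) (v t) (Q 0 - c) ee => e e' p u k ee.
  have -> : e * (e' * u - 0 + -2 * (p - k)) = e * e' * u - 2 * (e * (p - k)) by ring.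
  by rewrite ee mul1r.
exists z => //; split; last by rewrite /z mulr0 expR0 mul1r; ring.
split; first exact: is_dR_cont dz.
apply/decaysP => e e0; have e20 : 0 < e / 2 by lra.
have [T T0 Te] := dv _ e20; pose K := expR (2 * T) * `|z T|.
have K0 : 0 <= K by rewrite mulr_ge0 ?expR_ge0.
(* Past [2 K / e] the initial term [e^(-t) K] is at most [e / 2], because [t <= e^t]. *)
exists (Num.max T (2 * K / e)); first by rewrite le_max T0.
move=> t; rewrite ge_max => /andP[Tt Kt].
have := stable_bound T0 dz (fun t _ => erefl) Te Tt; rewrite -/K.
have : expR (- t) * K <= e / 2.
  rewrite expRN mulrC ler_pdivrMr ?expR_gt0//.
  have t1 : t <= expR t by have := expR_ge1Dx t; lra.
  rewrite ler_pdivrMr// in Kt.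
  have := ler_wpM2l (ltW e20) t1; lra.
lra.
Qed.

Lemma linop_surj N b y : (2 <= N)%N -> inY y ->
  exists2 z, inX N b z & eq0inf (linop N z) y.
Proof.
move=> N2 yY; have a0 : 0 <= N%:R - 2 :> R by rewrite subr_ge0 ler_nat.
have [v dv vY] := unstable_solution a0 yY.
(* The Navier condition on [z' = v - 2 z] reads [v(0) - 2 z(0) = (N - 2) z(0)], that is
   [z(0) = v(0) / N]. *)
pose c := match b with Dirichlet => 0 | Navier => v 0 / N%:R end.
have [z dz [zY z0]] := stable_solution c vY.
pose z1 t := v t - 2 * z t.
pose z2 t := (N%:R - 2) * v t - y t - 2 * z1 t.
have dz1 : is_dR z1 z2.
  apply: eq_is_dR (is_dR_lin (-2) dz dv) => t _; rewrite /z2 /z1 /=.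
    by move: (v t) (z t) => *; ring.
  by move: (N%:R - 2 : R) (v t) (z t) (y t) => *; ring.
have z1Y : inY z1 by apply: eq_inY (inY_lin (-2) zY vY) => t _; rewrite /z1; ring.
(* After expansion [z2 = (N - 4) v + 4 z - y], with [4 z] formed as [3 z + z]. *)
have z2Y : inY z2.
  have z4Y := inYB (inY_lin 3 zY zY) yY.
  apply: eq_inY (inY_lin (N%:R - 4) vY z4Y) => t _; rewrite /z2 /z1.
  by move: (N%:R : R) (v t) (z t) (y t) => *; ring.
have [|zX e1 e2] := @is_dR_inX _ N b _ _ _ dz dz1 zY z1Y z2Y.
  rewrite /z1 z0 /c; case: (b) => //.
  have : (N%:R : R) != 0 by rewrite pnatr_eq0 -lt0n (leq_trans _ N2).
  by move: (N%:R : R) (v 0) => n w n0; field.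
exists z => // t t0; rewrite /linop (e1 t t0) (e2 t t0) /z2 /z1.
by move: (N%:R : R) (v t) (z t) (y t) => *; ring.
Qed.

End Existence.

(** * Completeness of [Y] and the contraction principle *)

Section Completeness.
Variable R : realType.
Implicit Types (u w : R -> R) (q r C D e t : R) (n k : nat).

(** The hypothesis is pointwise rather than in terms of [wsup]: before [u] is known to lie in [Y], a
    small [wsup] could be the default value of [sup]. *)
Lemma inY_approx u :
  (forall e, 0 < e -> exists2 w, inY w & forall t, 0 <= t -> expR t * `|u t - w t| <= e) ->
  inY u.
Proof.
move=> ap; split; last first.
  apply/decaysP => e e0; have e20 : 0 < e / 2 by lra.
  have [w [_ /decaysP /(_ _ e20)[T T0 Te]] uw] := ap _ e20.
  exists T => // t Tt; have := Te t Tt; have := uw t (le_trans T0 Tt).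
  have : `|u t| <= `|u t - w t| + `|w t| by rewrite -{1}(subrK (w t) (u t)) ler_normD.
  rewrite -(ler_pM2l (expR_gt0 t)); lra.
apply/subspace_continuousP => x xD; apply/cvgrPdist_le => e e0.
have e40 : 0 < e / 4 by lra.
have [w [/subspace_continuousP cw _] uw] := ap _ e40.
have uwe s : 0 <= s -> `|u s - w s| <= e / 4.
  by move=> s0; apply: (le_trans _ (uw s s0)); rewrite ler_peMl// -expR0 ler_expR.
have /cvgrPdist_le/(_ _ e40) := cw x xD.
rewrite !near_withinE; apply: filterS => s h sD; have := h sD; rewrite /from_subspace.
have x0 : 0 <= x by move: xD; rewrite /= in_itv/= andbT.
have s0 : 0 <= s by move: sD; rewrite /= in_itv/= andbT.
have := uwe x x0; have := uwe s s0; rewrite !ler_norml.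
by move=> /andP[? ?] /andP[? ?] /andP[? ?]; apply/andP; split; lra.
Qed.

Lemma inY_limit (u_ : nat -> R -> R) q C : 0 <= q -> q < 1 ->
  (forall n, inY (u_ n)) ->
  (forall n, wsup (fun t => u_ n.+1 t - u_ n t) <= C * q ^+ n) ->
  exists2 u, inY u &
    forall n, wsup (fun t => u t - u_ n t) <= C / (1 - q) * q ^+ n.
Proof.
move=> q0 q1 uY uC; set D := C / (1 - q).
have CD : C = D * (1 - q) by rewrite divfK// gt_eqF// subr_gt0.
have C0 : 0 <= C by have := le_trans (wsup_ge0 _) (uC 0%N); rewrite expr0 mulr1.
have D0 : 0 <= D by rewrite divr_ge0//; lra.
have step t n : 0 <= t -> expR t * `|u_ n.+1 t - u_ n t| <= C * q ^+ n.
  by move=> ht; apply: (le_trans _ (uC n)); exact: (le_wsup (inYB (uY _) (uY _))).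
(* Keeping the term [- q ^+ (n + k)] lets the induction telescope, since
   [C q^j = D (q^j - q^(j + 1))]. *)
have tail t n k : 0 <= t ->
    expR t * `|u_ (n + k)%N t - u_ n t| <= D * (q ^+ n - q ^+ (n + k)).
  move=> ht; elim: k => [|k IH]; first by rewrite addn0 !subrr normr0 !mulr0.
  rewrite addnS; have := step t (n + k)%N ht.
  have : `|u_ (n + k).+1 t - u_ n t| <=
      `|u_ (n + k).+1 t - u_ (n + k)%N t| + `|u_ (n + k)%N t - u_ n t|.
    by rewrite ler_distD.
  rewrite -(ler_pM2l (expR_gt0 t)) exprS CD. lra.
have cvg t : 0 <= t -> exists l : R, u_ n t @[n --> \oo] --> l.
  (* Subtracting [D q^n] makes the weighted sequence nondecreasing, since its increments are at
     least [- C q^n]; monotone convergence then gives the limit. *)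
  move=> ht; pose a n := expR t * u_ n t - D * q ^+ n.
  have aE n : u_ n t = expR (- t) * (a n + D * q ^+ n).
    by rewrite /a subrK expRN mulKf// gt_eqF ?expR_gt0.
  have and_ : nondecreasing_seq a.
    apply/nondecreasing_seqP => n; have := step t n ht; rewrite /a.
    rewrite -[expR t in X in X -> _]ger0_norm ?expR_ge0// -normrM ler_norml.
    by move=> /andP[+ _]; rewrite exprS CD; lra.
  have aub : has_ubound (range a).
    exists (expR t * u_ 0%N t + D) => _ [n _ <-].
    have := tail t 0%N n ht; rewrite add0n expr0.
    have : 0 <= D * q ^+ n by rewrite mulr_ge0 ?exprn_ge0.
    rewrite -[expR t in X in _ -> X -> _]ger0_norm ?expR_ge0// -normrM ler_norml /a.
    by move=> ? /andP[_ ?]; lra.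
  have ac := nondecreasing_cvgn and_ aub.
  have qc : (q ^+ n) @[n --> \oo] --> (0 : R) by apply: cvg_expr; rewrite ger0_norm.
  exists (expR (- t) * (sup (range a) + D * 0)); under eq_fun do rewrite aE.
  by apply: cvgM; [exact: cvg_cst|apply: cvgD => //; apply: cvgM => //; exact: cvg_cst].
pose u t := lim (u_ n t @[n --> \oo]).
have ucv t : 0 <= t -> u_ n t @[n --> \oo] --> u t.
  by move=> /cvg[l lc]; rewrite /u (cvg_lim _ lc).
have ub t n : 0 <= t -> expR t * `|u t - u_ n t| <= D * q ^+ n.
  move=> ht.
  have h : expR t * `|u_ k t - u_ n t| @[k --> \oo] --> expR t * `|u t - u_ n t|.
    apply: cvgM; first exact: cvg_cst.
    by apply: cvg_norm; apply: cvgB; [exact: ucv|exact: cvg_cst].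
  apply: (cvgr_to_le h); near=> k.
  have nk : (n <= k)%N by near: k; exact: nbhs_infty_ge.
  have := tail t n (k - n)%N ht; rewrite subnKC// => /le_trans; apply.
  by rewrite ler_wpM2l// gerBl exprn_ge0.
exists u; last by move=> n; apply: wsup_le => t /ub.
apply: inY_approx => e e0.
have qc : D * (q ^+ n) @[n --> \oo] --> D * (0 : R).
  by apply: cvgM; [exact: cvg_cst|apply: cvg_expr; rewrite ger0_norm].
rewrite mulr0 in qc; have /cvgrPdist_le/(_ e e0)[n _ /(_ n (leqnn n))] := qc.
rewrite /= sub0r normrN => qe; exists (u_ n) => // t /ub /le_trans; apply.
exact: le_trans (ler_norm _) qe.
Unshelve. all: by end_near. Qed.

(** Picard iteration from 0 in the closed ball of radius [r]. Uniqueness is left out: it comes later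
    from the absorption estimates. *)
Lemma inY_fixpoint (T : (R -> R) -> R -> R) q r : 0 <= q -> q < 1 -> 0 <= r ->
  (forall u, inY u -> wsup u <= r -> inY (T u) /\ wsup (T u) <= r) ->
  (forall u w, inY u -> inY w -> wsup u <= r -> wsup w <= r ->
     wsup (fun t => T u t - T w t) <= q * wsup (fun t => u t - w t)) ->
  exists u, [/\ inY u, wsup u <= r & eq0inf (T u) u].
Proof.
move=> q0 q1 r0 Tr Tq; pose u_ n := iter n T (fun=> 0).
have uP n : inY (u_ n) /\ wsup (u_ n) <= r.
  elim: n => [|n [? ?]]; last by apply: Tr.
  split; first exact: inY0.
  by apply: wsup_le => t _; rewrite normr0 mulr0.
pose C := wsup (fun t => u_ 1%N t - u_ 0%N t).
have uC n : wsup (fun t => u_ n.+1 t - u_ n t) <= C * q ^+ n.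
  elim: n => [|n IH]; first by rewrite expr0 mulr1.
  rewrite exprS mulrCA; apply: le_trans (ler_wpM2l q0 IH).
  by apply: Tq; have [] := uP n; have [] := uP n.+1.
have [u uY ub] := inY_limit q0 q1 (fun n => (uP n).1) uC.
have qc : C / (1 - q) * (q ^+ n) @[n --> \oo] --> C / (1 - q) * (0 : R).
  by apply: cvgM; [exact: cvg_cst|apply: cvg_expr; rewrite ger0_norm].
rewrite mulr0 in qc.
have small e : 0 < e -> exists2 n, wsup (fun t => u t - u_ n t) <= e &
    wsup (fun t => u t - u_ n.+1 t) <= e.
  move=> e0; have /cvgrPdist_le/(_ e e0)[n _ nP] := qc.
  exists n; apply: (le_trans (ub _)); apply: (le_trans (ler_norm _)).
    by rewrite -normrN -sub0r; exact: (nP n (leqnn n)).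
  by rewrite -normrN -sub0r; exact: (nP n.+1 (leqnSn n)).
have ur : wsup u <= r.
  apply/ler_addgt0Pr => e e0; have [n une _] := small e e0.
  have [unY unr] := uP n.
  have := wsup_lin 1 (inYB uY unY) unY; rewrite normr1 mul1r.
  rewrite (@eq_wsup _ (fun t => 1 * (u t - u_ n t) + u_ n t) u); first by lra.
  by move=> t _; ring.
exists u; split => //; have [TuY Tur] := Tr u uY ur.
have TuuY := inYB TuY uY.
suff h : wsup (fun t => T u t - u t) <= 0.
  by move=> t ht; apply/eqP; rewrite -subr_eq0; apply/eqP; exact: (wsup_eq0 TuuY).
apply/ler_addgt0Pr => e e0; have e20 : 0 < e / 2 by lra.
(* [T u - u = (T u - T (u_ n)) - (u - u_ n.+1)], as [T (u_ n)] is [u_ n.+1]; each part is at most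
   [e / 2]. *)
have [n un un1] := small _ e20; have [unY unr] := uP n; have [un1Y _] := uP n.+1.
have TY : inY (fun t => T u t - T (u_ n) t) by exact: inYB TuY un1Y.
have := wsup_lin (-1) (inYB uY un1Y) TY; rewrite normrN1 mul1r.
have := Tq u (u_ n) uY unY ur unr.
rewrite (@eq_wsup _ (fun t => -1 * (u t - u_ n.+1 t) + (T u t - T (u_ n) t))
  (fun t => T u t - u t)); last first.
  by move=> t _; rewrite [u_ n.+1]/= -/(u_ n); ring.
have w0 := wsup_ge0 (fun t => u t - u_ n t).
have := ler_wpM2r w0 (ltW q1); rewrite mul1r.
lra.
Qed.

End Completeness.

(** * The forcing term belongs to [Y] *)

Section Forcing.
Variable R : realType.

Definition forcing N (g : R -> R) : R -> R :=
  fun t => expR ((N%:R - 4) * t) * Gint g (expR (- t)).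

(** The weight [e^t] turns the exponent [N - 4] into [N - 3], so decay is the limit hypothesis on
    [g]. Continuity is that of the indefinite integral on [[0, 1]], composed with [e^(-t)]. *)
Lemma inY_forcing N g :
  lebesgue_measure.-integrable `[0%R, 1%R] (EFin \o g) ->
  (fun t : R => expR ((N%:R - 3) * t) * Gint g (expR (- t))) @ +oo --> 0 ->
  inY (forcing N g).
Proof.
move=> ig lg; split; last first.
  rewrite /decays; have -> // : (fun t => expR t * forcing N g t) =
    (fun t : R => expR ((N%:R - 3) * t) * Gint g (expR (- t))).
  apply/funext => t; rewrite /forcing mulrA -expRD.
  by congr (expR _ * _); ring.
apply: cont0_expM.
have /subspace_continuousP cG := parameterized_integral_continuous ler01 ig.
apply/subspace_continuousP => x /=; rewrite in_itv/= andbT => x0.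
apply/cvgrPdist_le => e e0.
have e01 t : 0 <= t -> [set` `[0, 1]] (expR (- t) : R).
  by move=> t0; rewrite /= in_itv/= expR_ge0 -expR0 ler_expR oppr_le0.
have /cvgrPdist_le/(_ _ e0) := cG _ (e01 x x0).
have ce : expR (- t) @[t --> x] --> expR (- x).
  by apply: continuous_comp; [exact: opp_continuous|exact: continuous_expR].
rewrite !near_withinE => /ce h.
have {}h : \forall s \near x, [set` `[0, 1]] (expR (- s) : R) ->
  `|Gint g (expR (- x)) - Gint g (expR (- s))| <= e by exact: h.
near=> s; rewrite /= in_itv/= andbT => s0.
by apply: (near h s) => //; exact: e01.
Unshelve. all: by end_near. Qed.

End Forcing.

(* The equation [u = B u u + l k] for a bounded symmetric bilinear [B] on [Y],
   in the ball of radius [r] where [2 B u] is a contraction of ratio [1/2]. *)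
Section QuadraticEquation.
Variables (R : realType) (B : (R -> R) -> (R -> R) -> R -> R) (M r : R) (k : R -> R).
Hypothesis kY : inY k.
Hypothesis BY : forall u w, inY u -> inY w -> inY (B u w).
Hypothesis BC : forall u w t, B u w t = B w u t.
Hypothesis BL : forall a u w v, inY u -> inY w -> inY v ->
  eq0inf (B (fun t => a * u t + w t) v) (fun t => a * B u v t + B w v t).
Hypothesis BM : forall u w, inY u -> inY w -> wsup (B u w) <= M * (wsup u * wsup w).
Hypothesis M0 : 0 <= M.
Hypothesis r0 : 0 <= r.
Hypothesis Mr : 4 * (M * r) <= 1.
Implicit Types (u v w h y : R -> R) (l m t : R).

Definition solves l u :=
  [/\ inY u, wsup u <= r & eq0inf u (fun t => B u u t + l * k t)].

Let BR a u w v : inY u -> inY w -> inY v ->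
  eq0inf (B v (fun t => a * u t + w t)) (fun t => a * B v u t + B v w t).
Proof. by move=> uY wY vY t ht; rewrite BC BL// ![B _ v t]BC. Qed.

(** The form in which [4 M r <= 1] is used: [B u] has norm at most 1/4, so terms [2 B u h] can be
    absorbed. *)
Lemma wsup_B_le u w : inY u -> inY w -> wsup u <= r -> 4 * wsup (B u w) <= wsup w.
Proof.
move=> uY wY ur; have w0 := wsup_ge0 w.
have h1 := ler_wpM2l M0 (ler_wpM2r w0 ur).
have h2 := ler_wpM2r w0 Mr.
have := BM uY wY; lra.
Qed.

(** Absorption: [2 B w h] is at most half of [wsup h]. With [y = 0] it yields injectivity of the
    linearized equation. *)
Lemma linearized_le w h y : inY w -> wsup w <= r -> inY h -> inY y ->
  eq0inf h (fun t => 2 * B w h t + y t) -> wsup h <= 2 * wsup y.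
Proof.
move=> wY wr hY yY E; have := wsup_lin 2 (BY wY hY) yY.
rewrite -(eq_wsup E) ger0_norm//; have := wsup_B_le wY hY wr; lra.
Qed.

Lemma linearized_solvable w y : inY w -> wsup w <= r -> inY y ->
  exists2 h, inY h & eq0inf h (fun t => 2 * B w h t + y t).
Proof.
move=> wY wr yY; have y0 := wsup_ge0 y.
(* The radius [2 * wsup y] is preserved: half of it plus [wsup y] gives it back. *)
have [||||h1 h2|h [hY _ hE]] := @inY_fixpoint _ (fun h t => 2 * B w h t + y t) (1 / 2) (2 * wsup y).
- by lra.
- by lra.
- by lra.
- move=> h hY hr; split; first exact: inY_lin (BY wY hY) yY.
  apply: (le_trans (wsup_lin 2 (BY wY hY) yY)).
  by have := wsup_B_le wY hY wr; rewrite ger0_norm//; lra.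
- move=> h1Y h2Y _ _; pose d t := -1 * h2 t + h1 t.
  have dY : inY d by exact: inY_lin.
  rewrite (@eq_wsup _ (fun t => h1 t - h2 t) d); last by move=> t _; rewrite /d; ring.
  rewrite (@eq_wsup _ _ (fun t => 2 * B w d t + 0)); last first.
    by move=> t ht; rewrite (BR (-1) h2Y h1Y wY ht); ring.
  have := wsup_lin 2 (BY wY dY) (@inY0 R); have := wsup_B_le wY dY wr.
  have : wsup (fun=> 0 : R) <= 0 by apply: wsup_le => t _; rewrite normr0 mulr0.
  by rewrite ger0_norm//; lra.
by exists h => // t /hE.
Qed.

(** A difference of two squares: the cross terms cancel by symmetry of [B]. *)
Let BB u w d t : inY u -> inY w -> 0 <= t ->
  d = (fun t => -1 * u t + w t) -> B w w t - B u u t = 1 * B u d t + B w d t.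
Proof.
by move=> uY wY ht ->; rewrite !BR// (BC w u); ring.
Qed.

Lemma solution_exists l : 2 * (`|l| * wsup k) <= r -> exists u, solves l u.
Proof.
move=> lr.
(* On the ball [l * k] takes at most [r / 2] and [B u u] at most [r / 4]; in a difference [d],
   [B u d] and [B w d] contribute 1/4 each to the ratio. *)
have [||||u w|u [uY ur uE]] := @inY_fixpoint _ (fun u t => l * k t + B u u t) (1 / 2) r.
- by lra.
- by lra.
- by [].
- move=> u uY ur; split; first exact: inY_lin kY (BY uY uY).
  apply: (le_trans (wsup_lin l kY (BY uY uY))).
  have := wsup_B_le uY uY ur; have := r0; lra.
- move=> uY wY ur wr; pose d t := -1 * w t + u t.
  have dY : inY d by exact: inY_lin.
  rewrite (@eq_wsup _ (fun t => u t - w t) d); last by move=> t _; rewrite /d; ring.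
  rewrite (@eq_wsup _ _ (fun t => 1 * B w d t + B u d t)); last first.
    by move=> t ht; rewrite -(BB wY uY ht (erefl d)); ring.
  have := wsup_lin 1 (BY wY dY) (BY uY dY).
  have := wsup_B_le wY dY wr; have := wsup_B_le uY dY ur.
  by rewrite normr1; lra.
by exists u; split => // t ht; rewrite -(uE t ht) addrC.
Qed.

Lemma solves_le l u : solves l u -> wsup u <= 2 * (`|l| * wsup k).
Proof.
move=> [uY ur uE]; have := wsup_lin l kY (BY uY uY); have := wsup_B_le uY uY ur.
rewrite [X in _ -> X <= _ -> _](@eq_wsup _ _ u); last by move=> t ht; rewrite (uE t ht) addrC.
by have := wsup_ge0 u; lra.
Qed.

(** The difference satisfies [d = (m - l) k + B u d + B w d], whose last two terms absorb half of
    [d]. For [l = m] this is uniqueness, otherwise Lipschitz dependence. *)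
Lemma solves_diff l m u w : solves l u -> solves m w ->
  wsup (fun t => -1 * u t + w t) <= 2 * (`|m - l| * wsup k).
Proof.
move=> [uY ur uE] [wY wr wE]; set d := fun t => _.
have dY : inY d by exact: inY_lin.
have sY : inY (fun t => 1 * B u d t + B w d t) by apply: inY_lin; exact: BY.
have := wsup_lin (m - l) kY sY.
have := wsup_lin 1 (BY uY dY) (BY wY dY).
have := wsup_B_le uY dY ur; have := wsup_B_le wY dY wr.
rewrite normr1.
rewrite [X in _ -> _ -> _ -> X <= _ -> _](@eq_wsup _ _ d); last first.
  move=> t ht; rewrite -(BB uY wY ht (erefl d)) /d (uE t ht) (wE t ht).
  by move: (B w w t) (B u u t) (k t) => *; ring.
by have := wsup_ge0 d; lra.
Qed.

(** The remainder [e = d - (m - l) v] solves the linearized equation [e = 2 B u e + B d d], whose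
    source is quadratic in [d]; then [8 = 2 * 2^2] from [linearized_le] and [solves_diff]. *)
Lemma solves_derivative l m u w v : solves l u -> solves m w -> inY v ->
  eq0inf v (fun t => 2 * B u v t + k t) ->
  wsup (fun t => - (m - l) * v t + (-1 * u t + w t)) <=
    8 * M * wsup k ^+ 2 * `|m - l| ^+ 2.
Proof.
move=> us ws vY vE; have [uY ur uE] := us; have [wY wr wE] := ws.
have := solves_diff us ws; set d := fun t => -1 * u t + w t => dle.
have dY : inY d by exact: inY_lin.
set e := fun t => _.
have eY : inY e by exact: inY_lin.
have eE : eq0inf e (fun t => 2 * B u e t + B d d t).
  move=> t ht; rewrite (BR _ vY dY uY ht) (BL _ uY wY dY ht) /e (vE t ht) /d.
  rewrite [in LHS](uE t ht) [in LHS](wE t ht).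
  have := BB uY wY ht (erefl d); rewrite -/d.
  move: (B w w t) (B u u t) (B u d t) (B w d t) (B u v t) (k t) => b1 b2 b3 b4 b5 kt E.
  have -> : b1 = b2 + (1 * b3 + b4) by rewrite -E; ring.
  by ring.
apply: (le_trans (linearized_le uY ur eY (BY dY dY) eE)).
have := BM dY dY; have d0 := wsup_ge0 d.
have := ler_pM d0 d0 dle dle.
move=> /(ler_wpM2l M0); rewrite !expr2; lra.
Qed.

(** Here [e = v' - v] solves [e = 2 B u e + 2 B d v']. The factor 16 collects 2 from
    [linearized_le], 2 from the source, and 2 each from the bounds on [d] and [v']. *)
Lemma derivative_diff l m u w v v' : solves l u -> solves m w -> inY v -> inY v' ->
  eq0inf v (fun t => 2 * B u v t + k t) -> eq0inf v' (fun t => 2 * B w v' t + k t) ->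
  wsup (fun t => -1 * v t + v' t) <= 16 * M * wsup k ^+ 2 * `|m - l|.
Proof.
move=> us ws vY v'Y vE v'E; have [uY ur uE] := us; have [wY wr wE] := ws.
have := solves_diff us ws; set d := fun t => -1 * u t + w t => dle.
have dY : inY d by exact: inY_lin.
set e := fun t => _.
have eY : inY e by exact: inY_lin.
have BdY := BY dY v'Y.
have B2Y : inY (fun t => 2 * B d v' t + 0) by exact: inY_lin BdY (@inY0 R).
have eE : eq0inf e (fun t => 2 * B u e t + (2 * B d v' t + 0)).
  move=> t ht; rewrite (BR _ vY v'Y uY ht) (BL _ uY wY v'Y ht) /e (vE t ht) (v'E t ht).
  by move: (B u v t) (B u v' t) (B w v' t) (k t) => *; ring.
apply: (le_trans (linearized_le uY ur eY B2Y eE)).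
have := wsup_lin 2 BdY (@inY0 R); rewrite ger0_norm//.
have : wsup (fun=> 0 : R) <= 0 by apply: wsup_le => t _; rewrite normr0 mulr0.
have v'le := linearized_le wY wr v'Y kY v'E.
have := BM dY v'Y; have d0 := wsup_ge0 d; have v0 := wsup_ge0 v'.
have := ler_pM d0 v0 dle v'le.
move=> /(ler_wpM2l M0); rewrite !expr2; lra.
Qed.

End QuadraticEquation.

(** * The inverse of the linear part and the derivative of [Fmap] in [z] *)

Section Inverse.
Variables (R : realType) (N : nat) (b : bcond).
Hypothesis N2 : (2 <= N)%N.
Implicit Types (z w u y h : R -> R) (t : R).

Lemma linop_inj z w : inX N b z -> inX N b w ->
  eq0inf (linop N z) (linop N w) -> eq0inf z w.
Proof.
move=> zX wX E; have [dX _ _] := inX_lin (-1) zX wX; set d := fun t => _ in dX.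
have dE : eq0inf (linop N d) (fun=> 0).
  move=> t ht; rewrite (linop_lin (-1) zX wX ht) (E t ht).
  by move: (linop N w t) => x; ring.
have w0 : wsup (linop N d) <= 0.
  by rewrite (eq_wsup dE); apply: wsup_le => t _; rewrite normr0 mulr0.
have [_ _ dY _ _] := inX_is_dR dX.
have h : wsup d <= 0.
  apply: (le_trans (wsup_le_Xnorm d)); apply: (le_trans (Xnorm_le N2 dX)).
  by rewrite mulr_ge0_le0// mulr_ge0.
by move=> t /(wsup_eq0 dY h); rewrite /d; move: (z t) (w t) => x x'; lra.
Qed.

(** [K] is obtained by choice and is arbitrary outside [Y]; its linearity on [Y], up to [eq0inf], is
    recovered from [linop_inj]. *)
Lemma linop_inverse : exists K : (R -> R) -> R -> R,
  forall y, inY y -> inX N b (K y) /\ eq0inf (linop N (K y)) y.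
Proof.
have H y : exists z, inY y -> inX N b z /\ eq0inf (linop N z) y.
  have [yY|] := pselect (inY y); last by exists y.
  by have [z zX zE] := linop_surj b N2 yY; exists z.
by have [K KP] := choice H; exists K.
Qed.

Lemma FmapE g z l t :
  Fmap N g z l t = linop N z t - (N%:R - 1) / 2 * (z t * z t) - l * forcing N g t.
Proof. by rewrite /Fmap /forcing mulrA expr2. Qed.

Lemma inY_Fmap g z l : inY (forcing N g) -> inX N b z -> inY (Fmap N g z l).
Proof.
move=> gY zX; have [_ _ zY _ _] := inX_is_dR zX.
have h := inY_lin (- ((N%:R - 1) / 2)) (inYM zY zY) (inY_linop zX).
apply: eq_inY (inY_lin (- l) gY h) => t _; rewrite FmapE.
by move: (linop N z t) (z t) (forcing N g t) ((N%:R - 1) / 2) => *; ring.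
Qed.

(** The candidate for [F_z]; it does not depend on [lambda], which enters [Fmap] only through the
    forcing. *)
Definition dFmap z h : R -> R := fun t => linop N h t - (N%:R - 1) * (z t * h t).

Lemma dFmap_inY z h : inX N b z -> inX N b h -> inY (dFmap z h).
Proof.
move=> zX hX; have [_ _ zY _ _] := inX_is_dR zX; have [_ _ hY _ _] := inX_is_dR hX.
apply: eq_inY (inY_lin (- (N%:R - 1)) (inYM zY hY) (inY_linop hX)) => t _.
by rewrite /dFmap; move: (linop N h t) (z t) (h t) (N%:R : R) => *; ring.
Qed.

Lemma dFmap_lin z a h1 h2 : inX N b h1 -> inX N b h2 ->
  eq0inf (dFmap z (fun t => a * h1 t + h2 t)) (fun t => a * dFmap z h1 t + dFmap z h2 t).
Proof.
move=> h1X h2X t ht; rewrite /dFmap (linop_lin a h1X h2X ht).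
by move: (linop N h1 t) (linop N h2 t) (z t) (h1 t) (h2 t) (N%:R : R) => *; ring.
Qed.

Lemma dFmap_bounded z : inX N b z ->
  exists C, forall h, inX N b h -> wsup (dFmap z h) <= C * Xnorm h.
Proof.
move=> zX; have [_ _ zY _ _] := inX_is_dR zX.
pose n : R := N%:R - 1.
exists ((1 + `|N%:R - 4| + `|2 * N%:R - 4|) + `|n| * wsup z) => h hX.
have [_ _ hY _ _] := inX_is_dR hX.
have -> : wsup (dFmap z h) = wsup (fun t => - n * (z t * h t) + linop N h t).
  apply: eq_wsup => t _; rewrite /dFmap /n.
  by move: (linop N h t) (z t) (h t) (N%:R : R) => *; ring.
apply: (le_trans (wsup_lin (- n) (inYM zY hY) (inY_linop hX))); rewrite normrN.
have h1 := wsup_linop_le hX; have h2 := wsupM zY hY.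
have h3 := ler_wpM2l (wsup_ge0 z) (wsup_le_Xnorm h).
have h4 := ler_wpM2l (normr_ge0 n) (le_trans h2 h3).
rewrite mulrDl; move: h1 h4; rewrite -/n.
move: (Xnorm h) (wsup (linop N h)) (wsup (fun t => z t * h t)) (wsup z) => X l p w.
by move: (1 + _ + _) `|n| => L n'; lra.
Qed.

(** [Fmap] is quadratic in [z], so the remainder is exactly [- c h^2]. *)
Lemma dFmap_frechet g z l e : inX N b z -> 0 < e -> exists2 d, 0 < d &
  forall h, inX N b h -> Xnorm h < d ->
    wsup (fun t => Fmap N g (fun s => z s + h s) l t - Fmap N g z l t - dFmap z h t)
      <= e * Xnorm h.
Proof.
move=> zX e0; pose c : R := (N%:R - 1) / 2.
exists (e / (`|c| + 1)); first by rewrite divr_gt0// ltr_wpDl.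
move=> h hX; rewrite ltr_pdivlMr ?ltr_wpDl// => hd.
have [_ _ hY _ _] := inX_is_dR hX.
have E : eq0inf (fun t => Fmap N g (fun s => z s + h s) l t - Fmap N g z l t - dFmap z h t)
    (fun t => - c * (h t * h t) + 0).
  move=> t ht; rewrite !FmapE /dFmap.
  have -> : (fun s => z s + h s) = (fun s => 1 * z s + h s).
    by apply/funext => s; rewrite mul1r.
  rewrite (linop_lin 1 zX hX ht) /c.
  move: (linop N z t) (linop N h t) (z t) (h t) (forcing N g t) (N%:R : R) => *.
  by field.
rewrite (eq_wsup E); apply: (le_trans (wsup_lin (- c) (inYM hY hY) (@inY0 R))).
have : wsup (fun=> 0 : R) <= 0 by apply: wsup_le => t _; rewrite normr0 mulr0.
have h1 := wsupM hY hY; have h2 := wsup_le_Xnorm h; have h0 := wsup_ge0 h.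
have h3 := ler_pM h0 h0 h2 h2.
have h4 := ler_wpM2l (normr_ge0 c) (le_trans h1 h3).
have h5 := ler_wpM2r (Xnorm_ge0 h) (ltW hd).
have h6 := mulr_ge0 (Xnorm_ge0 h) (Xnorm_ge0 h).
rewrite normrN; move: h4 h5 h6.
move: (Xnorm h) (wsup (fun t => h t * h t)) (wsup (fun=> 0)) `|c| => X p o c'.
lra.
Qed.

End Inverse.

(** * From the quadratic equation in [Y] back to [z] in [X] *)

Theorem theorem4p5 (R : realType) (N : nat) (g : R -> R) (b : bcond)
  (hN : (2 <= N)%N)
  (hg : lebesgue_measure.-integrable `[0%R, 1%R] (EFin \o g))
  (hlim : (fun t : R => expR ((N%:R - 3) * t) * Gint g (expR (- t))) @ +oo --> 0) :
  (* F maps X x R into Y *)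
  (forall z lam, inX N b z -> inY (Fmap N g z lam)) /\
  exists (U : set (R -> R)) (I : set R) (zl : R -> (R -> R)),
    [/\ (* U is a neighborhood of 0 in X *)
        (U `<=` inX N b /\
        exists r : R, 0 < r /\ forall z, inX N b z -> Xnorm z < r -> U z),
        (* I is an open neighborhood of 0 *)
        (open I /\ I 0),
        (* existence and uniqueness in U *)
        (forall lam, I lam ->
           [/\ U (zl lam), eq0inf (Fmap N g (zl lam) lam) (fun=> 0) &
               forall w, U w -> eq0inf (Fmap N g w lam) (fun=> 0) ->
                 eq0inf w (zl lam)]),
        (* lam |-> z(lam) is C^1 from I into X *)
        ((exists dz : R -> (R -> R),
           forall lam, I lam ->
             inX N b (dz lam) /\
                 (forall eps : R, 0 < eps -> exists delta : R, 0 < delta /\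
                    forall mu, I mu -> 0 < `|mu - lam| < delta ->
                      Xnorm (fun t => zl mu t - zl lam t - (mu - lam) * dz lam t)
                        <= eps * `|mu - lam|) /\
                 (forall eps : R, 0 < eps -> exists delta : R, 0 < delta /\
                    forall mu, I mu -> `|mu - lam| < delta ->
                      Xnorm (fun t => dz mu t - dz lam t) <= eps)) /\
        (* z(0) = 0 *)
        eq0inf (zl 0) (fun=> 0)) &
        (* F_z(z(lam), lam) : X -> Y exists (Frechet derivative in z,
           bounded linear) and is bijective *)
        (forall lam, I lam ->
           exists L : (R -> R) -> (R -> R),
             [/\ (forall h, inX N b h -> inY (L h)),
                 ((forall (a : R) h1 h2, inX N b h1 -> inX N b h2 ->
                   eq0inf (L (fun t => a * h1 t + h2 t))
                          (fun t => a * L h1 t + L h2 t)) /\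
                 (exists C : R, forall h, inX N b h -> Ynorm (L h) <= C * Xnorm h)),
                 (forall eps : R, 0 < eps -> exists delta : R, 0 < delta /\
                    forall h, inX N b h -> 0 < Xnorm h < delta ->
                      Ynorm (fun t => Fmap N g (fun s => zl lam s + h s) lam t
                                      - Fmap N g (zl lam) lam t - L h t)
                        <= eps * Xnorm h),
                 (* injective on X *)
                 (forall h1 h2, inX N b h1 -> inX N b h2 ->
                    eq0inf (L h1) (L h2) -> eq0inf h1 h2) &
                 (* surjective onto Y *)
                 (forall y, inY y -> exists h, inX N b h /\ eq0inf (L h) y)])].
Proof.
have gY := inY_forcing hg hlim; set k := forcing N g in gY.
split; first by move=> z l; exact: inY_Fmap.
have [K KP] := linop_inverse R b hN.
pose A : R := 9 * N%:R.
have A0 : 0 <= A by rewrite mulr_ge0.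
pose c : R := (N%:R - 1) / 2.
have c0 : 0 <= c.
  by rewrite divr_ge0// subr_ge0 ler1n; exact: leq_trans hN.
have KX u : inY u -> inX N b (K u) by move=> /KP[].
have KE u : inY u -> eq0inf (linop N (K u)) u by move=> /KP[].
have KY u : inY u -> inY (K u) by move=> /KX/inX_is_dR[].
have Kle u : inY u -> Xnorm (K u) <= A * wsup u.
  by move=> uY; apply: (le_trans (Xnorm_le hN (KX u uY))); rewrite (eq_wsup (KE u uY)).
have Klin a u w : inY u -> inY w ->
    eq0inf (K (fun t => a * u t + w t)) (fun t => a * K u t + K w t).
  move=> uY wY; have uwY := inY_lin a uY wY.
  have [lX _ _] := inX_lin a (KX u uY) (KX w wY).
  apply: (linop_inj hN (KX _ uwY) lX) => t ht.
  by rewrite (KE _ uwY t ht) (linop_lin a (KX u uY) (KX w wY) ht) (KE u uY t ht) (KE w wY t ht).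
pose B u w t := c * (K u t * K w t).
(* Each factor [K u] costs one norm [A] of the inverse. *)
pose M := c * A ^+ 2.
have M0 : 0 <= M by rewrite mulr_ge0// exprn_ge0.
have BY u w : inY u -> inY w -> inY (B u w).
  move=> uY wY; apply: eq_inY (inY_lin c (inYM (KY u uY) (KY w wY)) (@inY0 R)) => t _.
  by rewrite addr0.
have BC u w t : B u w t = B w u t by rewrite /B [K u t * _]mulrC.
have BL a u w v : inY u -> inY w -> inY v ->
    eq0inf (B (fun t => a * u t + w t) v) (fun t => a * B u v t + B w v t).
  move=> uY wY vY t ht; rewrite /B (Klin a u w uY wY t ht).
  by move: (K u t) (K w t) (K v t) => *; ring.
have BM u w : inY u -> inY w -> wsup (B u w) <= M * (wsup u * wsup w).
  move=> uY wY.
  have -> : wsup (B u w) = wsup (fun t => c * (K u t * K w t) + 0).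
    by apply: eq_wsup => t _; rewrite addr0.
  apply: (le_trans (wsup_lin c (inYM (KY u uY) (KY w wY)) (@inY0 R))).
  have : wsup (fun=> 0 : R) <= 0 by apply: wsup_le => t _; rewrite normr0 mulr0.
  have h1 := wsupM (KY u uY) (KY w wY).
  have h2 := le_trans (wsup_le_Xnorm (K u)) (Kle u uY).
  have h3 := le_trans (wsup_le_Xnorm (K w)) (Kle w wY).
  have h4 := ler_pM (wsup_ge0 _) (wsup_ge0 _) h2 h3.
  have h5 := ler_wpM2l c0 (le_trans h1 h4).
  rewrite ger0_norm// /M expr2; lra.
pose r := (4 * (M + 1))^-1.
have r0 : 0 < r by rewrite invr_gt0; lra.
have Mr : 4 * (M * r) <= 1.
  have : 4 * (M + 1) * r = 1 by rewrite divff// gt_eqF//; lra.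
  lra.
have k0 := wsup_ge0 k.
(* Chosen so that [|l| < dl] gives the smallness required by [solution_exists]; adding 1 keeps the
   denominator positive even when [k] vanishes. *)
pose dl := r / (2 * (wsup k + 1)).
have dl0 : 0 < dl by rewrite divr_gt0//; lra.
have dlP (l : R) : `|l| < dl -> 2 * (`|l| * wsup k) <= r.
  by rewrite ltr_pdivlMr; [have := normr_ge0 l; lra|lra].
have r0' := ltW r0.
have /choice[u uP] : forall l, exists w, `|l| < dl -> solves B r k l w.
  move=> l; have [ll|ll] := boolP (`|l| < dl); last by exists (fun=> 0).
  by have [u us] := solution_exists gY BY BC BL BM M0 r0' Mr (dlP l ll); exists u.
have uY l : `|l| < dl -> inY (u l) by move=> /uP[].
have ur l : `|l| < dl -> wsup (u l) <= r by move=> /uP[].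
have lin w y (wY : inY w) wr yY :=
  @linearized_solvable R B M r BY BC BL BM M0 Mr w y wY wr yY.
have /choice[v vP] : forall l, exists w, `|l| < dl ->
    inY w /\ eq0inf w (fun t => 2 * B (u l) w t + k t).
  move=> l; have [ll|ll] := boolP (`|l| < dl); last by exists (fun=> 0).
  by have [v vY vE] := lin (u l) k (uY l ll) (ur l ll) gY; exists v.
pose L : R := 1 + `|N%:R - 4| + `|2 * N%:R - 4|.
have L0 : 0 < L by rewrite /L ltr_wpDr ?normr_ge0 ?ltr_wpDr ?normr_ge0 ?ltr01.
have IP l : ball (0 : R) dl l -> `|l| < dl by rewrite -ball_normE /= sub0r normrN.
have solF w : inX N b w -> inY (linop N w) ->
    eq0inf w (K (linop N w)).
  by move=> wX yY; apply: (linop_inj hN wX (KX _ yY)) => t ht; rewrite (KE _ yY t ht).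
(* [U] is the preimage under [linop N] of the ball of radius [r] in [Y], so uniqueness in [U] is
   uniqueness for [u] in that ball. *)
exists [set z | inX N b z /\ wsup (linop N z) <= r], (ball 0 dl), (fun l => K (u l)); split.
- split; first by move=> z [].
  exists (r / L); split=> [|z zX]; first by rewrite divr_gt0.
  rewrite ltr_pdivlMr// => zr; split => //.
  by apply: (le_trans (wsup_linop_le zX)); rewrite mulrC ltW.
- split; first exact: ball_open.
  exact: ballxx.
- move=> l /IP ll; have us := uP l ll; have [ulY ulr ulE] := us; split.
  + split; first exact: KX.
    by rewrite (eq_wsup (KE _ ulY)).
  + move=> t ht; rewrite FmapE (KE _ ulY t ht) (ulE t ht) /B -/c.
    by rewrite -/k; move: (K (u l) t) (k t) => *; ring.
  + move=> w [wX wr] wF; have yY := inY_linop wX.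
    have ws : solves B r k l (linop N w).
      split => // t ht; have := wF t ht; rewrite FmapE -/c -/k /B.
      rewrite -(solF w wX yY t ht) => E.
      by rewrite -[LHS]subr0 -E; move: (linop N w t) (w t) (k t) => *; ring.
    have := solves_diff gY BY BC BL BM M0 Mr us ws.
    rewrite subrr normr0 mul0r mulr0 => h.
    have dY := inY_lin (-1) ulY yY.
    apply: (linop_inj hN wX (KX _ ulY)) => t ht; rewrite (KE _ ulY t ht).
    by have := wsup_eq0 dY h ht; move: (linop N w t) (u l t) => x x'; lra.
- split.
    exists (fun l => K (v l)) => l /IP ll; have us := uP l ll; have [vY vE] := vP l ll.
    split; first exact: KX.
    split=> e e0.
      (* The quadratic remainder estimate for [u], carried to [X] at the cost of a factor [A]. *)
      pose C := A * (8 * M * wsup k ^+ 2).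
      have C0 : 0 <= C by apply: mulr_ge0 A0 (mulr_ge0 (mulr_ge0 _ M0) (exprn_ge0 _ k0)).
      exists (e / (C + 1)); split; first by rewrite divr_gt0// ltr_wpDl.
      move=> m /IP mm /andP[_]; rewrite ltr_pdivlMr ?ltr_wpDl// => ml.
      have ws := uP m mm.
      have h := solves_derivative gY BY BC BL BM M0 Mr us ws vY vE.
      set d := - (m - l) in h.
      have [d1X _ _] := inX_lin (-1) (KX _ (uY l ll)) (KX _ (uY m mm)).
      have [d2X _ _] := inX_lin d (KX _ vY) d1X.
      have -> : (fun t => K (u m) t - K (u l) t - (m - l) * K (v l) t) =
          (fun t => d * K (v l) t + (-1 * K (u l) t + K (u m) t)).
        by apply/funext => t; rewrite /d; move: (K (u m) t) (K (u l) t) (K (v l) t) => *; ring.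
      apply: (le_trans (Xnorm_le hN d2X)).
      rewrite (@eq_wsup _ _ (fun t => d * v l t + (-1 * u l t + u m t))); last first.
        move=> t ht; rewrite (linop_lin d (KX _ vY) d1X ht).
        rewrite (linop_lin (-1) (KX _ (uY l ll)) (KX _ (uY m mm)) ht).
        by rewrite (KE _ vY t ht) (KE _ (uY l ll) t ht) (KE _ (uY m mm) t ht).
      apply: (le_trans (ler_wpM2l A0 h)).
      have n0 := normr_ge0 (m - l).
      have := ler_wpM2r n0 (ltW ml); rewrite /C expr2.
      have := mulr_ge0 n0 n0; lra.
    pose C := A * (16 * M * wsup k ^+ 2).
    have C0 : 0 <= C by apply: mulr_ge0 A0 (mulr_ge0 (mulr_ge0 _ M0) (exprn_ge0 _ k0)).
    exists (e / (C + 1)); split; first by rewrite divr_gt0// ltr_wpDl.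
    move=> m /IP mm; rewrite ltr_pdivlMr ?ltr_wpDl// => ml.
    have ws := uP m mm; have [v'Y v'E] := vP m mm.
    have h := derivative_diff gY BY BC BL BM M0 Mr us ws vY v'Y vE v'E.
    have [dX _ _] := inX_lin (-1) (KX _ vY) (KX _ v'Y).
    have -> : (fun t => K (v m) t - K (v l) t) = (fun t => -1 * K (v l) t + K (v m) t).
      by apply/funext => t; rewrite mulN1r addrC.
    apply: (le_trans (Xnorm_le hN dX)).
    rewrite (@eq_wsup _ _ (fun t => -1 * v l t + v m t)); last first.
      move=> t ht; rewrite (linop_lin (-1) (KX _ vY) (KX _ v'Y) ht).
      by rewrite (KE _ vY t ht) (KE _ v'Y t ht).
    apply: (le_trans (ler_wpM2l A0 h)).
    by have := normr_ge0 (m - l); move: ml; rewrite /C; lra.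
  have zz : `|0 : R| < dl by rewrite normr0.
  have h := solves_le gY BY BM M0 Mr (uP 0 zz).
  rewrite normr0 mul0r mulr0 in h.
  apply: (wsup_eq0 (KY _ (uY 0 zz))); apply: (le_trans (wsup_le_Xnorm _)).
  by apply: (le_trans (Kle _ (uY 0 zz))); rewrite mulr_ge0_le0.
- move=> l /IP ll; have ulY := uY l ll; have ulX := KX _ ulY.
  have zero : wsup (fun=> 0 : R) <= 0 by apply: wsup_le => t _; rewrite normr0 mulr0.
  exists (dFmap N (K (u l))); split.
  + by move=> h; exact: dFmap_inY.
  + by split; [move=> a h1 h2; exact: dFmap_lin|exact: dFmap_bounded].
  + move=> e e0; have [d d0 dP] := dFmap_frechet g l ulX e0.
    by exists d; split => // h hX /andP[_]; exact: dP.
  + move=> h1 h2 h1X h2X E.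
    have [hX _ _] := inX_lin (-1) h1X h2X; set h := fun t => _ in hX.
    have yY := inY_linop hX.
    have hE := solF h hX yY.
    (* In terms of [linop N h], equality of the two images is the linearized equation with zero
       source, because [N - 1 = 2 c]. *)
    have yE : eq0inf (linop N h) (fun t => 2 * B (u l) (linop N h) t + 0).
      move=> t ht; rewrite /B -(hE t ht) (linop_lin (-1) h1X h2X ht) /h /c.
      have := E t ht; rewrite /dFmap.
      move: (linop N h1 t) (linop N h2 t) (h1 t) (h2 t) (K (u l) t) (N%:R : R).
      move=> y1 y2 x1 x2 z n e.
      have -> : y2 = y1 - (n - 1) * (z * x1) + (n - 1) * (z * x2) by rewrite e; ring.
      by field.
    have := linearized_le BY BM M0 Mr ulY (ur l ll) yY (@inY0 R) yE.
    move=> y0; have {}y0 : wsup (linop N h) <= 0 by lra.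
    apply: (linop_inj hN h1X h2X) => t ht.
    have := wsup_eq0 yY y0 ht; rewrite (linop_lin (-1) h1X h2X ht).
    by move: (linop N h1 t) (linop N h2 t) => *; lra.
  (* The preimage of [y] is [K f], where [f = 2 B (u l) f + y]. *)
  + move=> y yY; have [f fY fE] := lin (u l) y ulY (ur l ll) yY.
    exists (K f); split; first exact: KX.
    move=> t ht; rewrite /dFmap (KE _ fY t ht) (fE t ht) /B /c.
    by move: (K (u l) t) (K f t) (y t) (N%:R : R) => *; field.
Qed.
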